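(* Let $A$ and $B$ be disjoint finite point sets in the plane with $|A|=|B|=n$ such that every $AB$-line contains at most three points of $A\cup B$. Then the bivisibility graph $\mathcal{B}(A,B)$ contains a non-crossing spanning tree.
   Context: An $AB$-line is a line containing at least one point of $A$ and at least one point of $B$. The bivisibility graph $\mathcal{B}(A,B)$ has vertex set $A\cup B$, where $v\in A$ and $w\in B$ are adjacent iff no point of $A\cup B$ lies in the open segment $vw$. Edges are drawn as straight segments; a subgraph is non-crossing if no two of its edges intersect except at a common endpoint. *)

(* Defs.v *)
From HB Require Import structures.
From mathcomp Require Import all_boot all_order all_algebra finmap.
From mathcomp Require Import boolp classical_sets set_interval reals.

Set Implicit Arguments.
Unset Strict Implicit.
Unset Printing Implicit Defensive.

Import Order.TTheory GRing.Theory Num.Theory.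

Local Open Scope ring_scope.
Local Open Scope classical_set_scope.

Notation plane R := 'rV[R]_2.

Section Geometry.
Variable R : realType.
Implicit Types (p q d v w : plane R) (L : set (plane R)) (A B : {fset plane R}).

Definition segment v w : set (plane R) :=
  [set (1 - t) *: v + t *: w | t in `[0, 1]].

(* For v = w this is the singleton [set v], not the empty set; only the case
   v != w is used below. *)
Definition open_segment v w : set (plane R) :=
  [set (1 - t) *: v + t *: w | t in `]0, 1[].

Definition is_line L : Prop :=
  exists p d, d != 0 /\ L = [set p + t *: d | t in [set: R]].

Definition AB_line A B L : Prop :=
  [/\ is_line L, exists2 a, a \in A & L a & exists2 b, b \in B & L b].

End Geometry.

Section Graphs.
Variable V : finType.
Implicit Types (g t : rel V).

Definition simple_graph g : Prop := symmetric g /\ irreflexive g.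

(* In a simple graph, a cycle is a closed walk on at least three vertices that
   repeats none of them; shorter vertex sequences do not count. *)
Definition acyclic g : Prop := forall c : seq V, (2 < size c)%N -> ~ ucycle g c.

Definition connected g : Prop := forall x y, connect g x y.

(* The graph with no vertices satisfies this definition. *)
Definition tree g : Prop := [/\ simple_graph g, connected g & acyclic g].

Definition spanning_tree g t : Prop := subrel t g /\ tree t.

End Graphs.

Section GeometricGraphs.
Variable R : realType.
Implicit Types (A B S : {fset plane R}).

Definition bivisibility A B : rel (A `|` B)%fset := fun v w =>
  ((val v \in A) && (val w \in B) || (val v \in B) && (val w \in A)) &&
  [forall z : (A `|` B)%fset, val z \notin open_segment (val v) (val w)].

Definition noncrossing S (g : rel S) : Prop :=
  forall u v x y : S, g u v -> g x y -> [set u; v]%SET != [set x; y]%SET ->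
  forall p, segment (val u) (val v) p -> segment (val x) (val y) p ->
  (p = val u \/ p = val v) /\ (p = val x \/ p = val y).

End GeometricGraphs.

Arguments bivisibility {R} A B v w.

(* Main.v *)
Require Import Defs.
From HB Require Import structures.
From mathcomp Require Import all_boot all_order all_algebra finmap.
From mathcomp Require Import boolp classical_sets set_interval reals.
From mathcomp Require Import ring lra zify.

(** Write P for the set of all points. It suffices to draw a connected
    non-crossing bivisibility graph, since any spanning tree of it will do. Two
    drawings that share a point and are otherwise separated by a line can be
    glued, so one looks for a way of cutting P into smaller sets. Let v be an
    extreme point of P; count a point of P minus v as -1 if it has the colour of
    v and as +1 otherwise. The induction is on two kinds of sets: the total
    weight around v is 1 (P is balanced), or it is 0 (v is an additional point)
    and then some ray from v must not consist of a blocker followed by a point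
    of the other colour, as otherwise v could be isolated. Sweep P by a ray
    from v. If the first or last ray contains a point of the other colour, it
    contains a two-coloured edge of the hull, which is removed and put back
    after induction. Otherwise the prefix weights start negative and end above
    the total, and a step of the sweep raises them by at most 2, because
    two-coloured lines have at most three points. At the first nonnegative
    prefix weight, which is 0 or 1, one cuts P along the ray into two sets
    sharing v. Only total 0 and prefix weight 1 does not allow this; then the
    ray holds exactly two points of the other colour, and one cuts P into two
    balanced sets that share one of these two points instead of v. *)

Set Implicit Arguments.
Unset Strict Implicit.
Unset Printing Implicit Defensive.

Import Order.TTheory GRing.Theory Num.Theory.

Local Open Scope ring_scope.

(** * Spanning trees of finite connected graphs *)

(** Deleting an edge of a cycle keeps the graph connected; the induction is on the number of ordered
    adjacent pairs. *)
Lemma has_spanning_tree (V : finType) (g : rel V) :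
  simple_graph g -> connected g -> exists t : rel V, spanning_tree g t.
Proof.
have [n] := ubnP #|[pred e : V * V | g e.1 e.2]|.
elim: n g => // n IHn g; rewrite ltnS => size_g [g_sym g_irr] g_conn.
have [g_acyc|] := pselect (acyclic g); first by exists g; do 2?split.
move/existsNP=> [c] /not_implyP[c_gt2] /contrapT /andP[].
case: c c_gt2 => [|x [|y [|z p]]] // _ /= /and3P[gxy gyz gzp].
rewrite !inE !negb_or -!andbA => /and5P[xy xz xp yz] /andP[yp _].
pose h u v := g u v && ([set u; v] != [set x; y])%SET.
have h_sym : symmetric h by move=> u v; rewrite /h g_sym finset.setUC.
have hg : subrel h g by move=> u v /andP[].
(* The rest of the cycle leads from [y] through [z] back to [x]: its first edge avoids [x], and
   after that it never returns to [y]. *)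
have h_yx : connect h y x.
  apply/connectP; exists (z :: rcons p x); last by rewrite /= last_rcons.
  rewrite /= {1}/h gyz /=; apply/andP; split.
    apply/eqP => /finset.setP/(_ x); rewrite !inE eqxx (negbTE xy) (negbTE xz).
    by [].
  apply: (sub_in_path (P := predC1 y)) gzp.
    move=> u v /= uy vy guv; rewrite /h guv /=; apply/eqP => /finset.setP/(_ y).
    by rewrite !inE eqxx orbT ![y == _]eq_sym (negbTE uy) (negbTE vy).
  rewrite /= eq_sym yz all_rcons /= xy /=; apply/allP => u up /=.
  by apply: contraNneq yp => <-.
have h_csym : connect_sym h by exact: sym_connect_sym.
have [|||t [t_h t_tree]] := IHn h.
- apply: leq_trans size_g; apply: proper_card; apply/properP; split.
    by apply/fintype.subsetP => -[u v]; rewrite !inE => /hg.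
  by exists (x, y); rewrite !inE //= /h gxy eqxx.
- by split=> // u; rewrite /h g_irr.
- move=> u v; have := g_conn u v; apply: connect_sub => {}u {}v guv.
  have [e|ne] := eqVneq [set u; v]%SET [set x; y]%SET; last first.
    by apply: connect1; rewrite /h guv.
  move/finset.setP: e => e; have := e u; have := e v; rewrite !inE !eqxx ?orbT /=.
  move=> /esym/orP[]/eqP ev /esym/orP[]/eqP eu; subst u v;
    by [exact: connect0 | | rewrite h_csym].
by exists t; split=> // u v /t_h /hg.
Qed.

Lemma finite_argmin (T : finType) (R : realDomainType) (Q : pred T) (f : T -> R) :
  (exists x, Q x) -> exists2 x, Q x & forall y, Q y -> f x <= f y.
Proof. by case=> x0 Qx0; case: (arg_minP f Qx0) => x Qx xmin; exists x. Qed.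

(** * Plane geometry *)

Section Plane.
Variable R : realType.
Implicit Types p q u v w d : plane R.

Definition dot u v : R := u 0 0 * v 0 0 + u 0 1 * v 0 1.
Definition cross u v : R := u 0 0 * v 0 1 - u 0 1 * v 0 0.

Lemma planeP u v : u 0 0 = v 0 0 -> u 0 1 = v 0 1 -> u = v.
Proof.
move=> e0 e1; apply/rowP => i; case: i => -[|[|//]] i.
  by rewrite (_ : Ordinal i = 0) //; apply: val_inj.
by rewrite (_ : Ordinal i = 1) //; apply: val_inj.
Qed.

Lemma dot_gt0 u : u != 0 -> 0 < dot u u.
Proof.
move=> u0; rewrite lt0r /dot -!expr2 addr_ge0 ?sqr_ge0 // andbT.
apply: contra u0; rewrite paddr_eq0 ?sqr_ge0 // !sqrf_eq0.
by case/andP=> /eqP e0 /eqP e1; apply/eqP/planeP; rewrite ?e0 ?e1 mxE.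
Qed.

Lemma dotZr d t u : dot d (t *: u) = t * dot d u.
Proof. by rewrite /dot !mxE; ring. Qed.

Lemma crossZr d t u : cross d (t *: u) = t * cross d u.
Proof. by rewrite /cross !mxE; ring. Qed.

(** Lagrange's identity: |d|^2 |w|^2 is the sum of the squares of the dot and cross products of d
    and w, taken at w = u - v. *)
Lemma dot_cross_inj d u v :
  d != 0 -> dot d u = dot d v -> cross d u = cross d v -> u = v.
Proof.
move=> d0 e_dot e_cross; apply/eqP; rewrite -subr_eq0; apply: contraTT isT => uv.
have : 0 < dot d d * dot (u - v) (u - v) by rewrite mulr_gt0 ?dot_gt0.
have -> : dot d d * dot (u - v) (u - v) =
    (dot d u - dot d v) ^+ 2 + (cross d u - cross d v) ^+ 2.
  by rewrite /dot /cross !mxE; ring.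
by rewrite e_dot e_cross !subrr expr0n addr0 ltxx.
Qed.

Definition affine_fun (h : plane R -> R) : Prop :=
  forall t u v, h ((1 - t) *: u + t *: v) = (1 - t) * h u + t * h v.

Lemma affine_scale k h : affine_fun h -> affine_fun (fun p => k * h p).
Proof. by move=> hh t u v; rewrite hh; ring. Qed.

End Plane.

(** * Lexicographic signs of pairs *)

Section LexConvexity.
Variable R : realFieldType.
Implicit Types (a b : R * R) (t : R).

(** For the values of two affine functions, these signs describe an open half-plane with a part of
    its boundary line, so that a cut may run along a line carrying several points. *)
Definition lex_nneg a := 0 < a.1 \/ a.1 = 0 /\ 0 <= a.2.
Definition lex_neg a := a.1 < 0 \/ a.1 = 0 /\ a.2 < 0.

Lemma lex_neg_conv t a b : 0 <= t <= 1 -> lex_neg a -> lex_neg b ->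
  lex_neg ((1 - t) * a.1 + t * b.1, (1 - t) * a.2 + t * b.2).
Proof.
rewrite /lex_neg /= => /andP[t0 t1].
(* At the ends of the segment one coefficient vanishes; the strict inequalities below need both to
   be positive. *)
have [->|tn0] := eqVneq t 0; first by rewrite subr0 !mul1r !mul0r !addr0.
have [->|tn1] := eqVneq t 1; first by rewrite subrr !mul1r !mul0r !add0r.
have {t0 tn0} t0 : 0 < t by rewrite lt0r tn0.
have {t1 tn1} t1 : 0 < 1 - t by rewrite subr_gt0 lt_neqAle tn1.
by move=> [a1|[-> a2]] [b1|[-> b2]]; [left; nra|left; nra|left; nra|right; nra].
Qed.

Lemma lex_nneg_conv t a b : 0 <= t <= 1 -> lex_nneg a -> lex_nneg b ->
  lex_nneg ((1 - t) * a.1 + t * b.1, (1 - t) * a.2 + t * b.2).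
Proof.
rewrite /lex_nneg /= => /andP[t0 t1].
have [->|tn0] := eqVneq t 0; first by rewrite subr0 !mul1r !mul0r !addr0.
have [->|tn1] := eqVneq t 1; first by rewrite subrr !mul1r !mul0r !add0r.
have {t0 tn0} t0 : 0 < t by rewrite lt0r tn0.
have {t1 tn1} t1 : 0 < 1 - t by rewrite subr_gt0 lt_neqAle tn1.
by move=> [a1|[-> a2]] [b1|[-> b2]]; [left; nra|left; nra|left; nra|right; nra].
Qed.

Lemma lex_nneg_neg a : lex_nneg a -> ~ lex_neg a.
Proof. by rewrite /lex_nneg /lex_neg; lra. Qed.

Lemma lex_nneg_diag (r : R) : 0 <= r -> lex_nneg (r, r).
Proof.
by rewrite le0r => /orP[/eqP->|r0]; [right; rewrite /= lexx|left].
Qed.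

End LexConvexity.

(** * Closed and open segments *)

Section Segments.
Variable R : realType.
Implicit Types a b p : plane R.

Lemma segment_refl a : segment a a a.
Proof.
exists 0; first by rewrite /= in_itv /= lexx ler01.
by rewrite subr0 scale1r scale0r addr0.
Qed.

Lemma open_segmentW a b p : open_segment a b p -> segment a b p.
Proof.
case=> t; rewrite /= !in_itv /= => /andP[t0 t1] <-.
by exists t => //; rewrite /= in_itv /= !ltW.
Qed.

Lemma segment_split a b p :
  segment a b p -> [\/ p = a, p = b | open_segment a b p].
Proof.
case=> t; rewrite /= !in_itv /= => /andP[t0 t1] <-.
have [->|tn0] := eqVneq t 0.
  by apply: Or31; rewrite subr0 scale1r scale0r addr0.
have [->|tn1] := eqVneq t 1.
  by apply: Or32; rewrite subrr scale1r scale0r add0r.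
by apply: Or33; exists t => //; rewrite /= in_itv /= lt0r tn0 t0 lt_neqAle tn1.
Qed.

Lemma open_segmentNl a b : a != b -> ~ open_segment a b a.
Proof.
move=> ab [t]; rewrite /= in_itv /= => /andP[t0 _] e.
have /eqP : t *: (b - a) = 0.
  by apply: (addrI a); rewrite addr0 -[RHS]e scalerBl scale1r scalerBr addrCA addrC.
by rewrite scaler_eq0 subr_eq0 gt_eqF //= eq_sym (negbTE ab).
Qed.

Lemma open_segmentC a b p : open_segment a b p -> open_segment b a p.
Proof.
case=> t; rewrite /= in_itv /= => /andP[t0 t1] <-.
exists (1 - t); last by rewrite subKr addrC.
by rewrite /= in_itv /= subr_gt0 t1 gtrBl t0.
Qed.

End Segments.

(** * Gluing drawings *)

Section Drawings.
Variables (R : realType) (T : finType) (pt : T -> plane R) (col : T -> bool).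
Hypothesis pt_inj : injective pt.
Implicit Types (P Q : {set T}) (g : rel T) (u v w x y z : T).

Definition noncrossing_drawing g : Prop :=
  forall u v x y, g u v -> g x y -> [set u; v]%SET != [set x; y]%SET ->
  forall p, segment (pt u) (pt v) p -> segment (pt x) (pt y) p ->
  (p = pt u \/ p = pt v) /\ (p = pt x \/ p = pt y).

(** Only points of [P] count as blockers, so an edge found for a part has to be checked again when
    parts are united. *)
Definition bivisible P u v : Prop :=
  [/\ u \in P, v \in P, col u != col v
    & forall z, z \in P -> ~ open_segment (pt u) (pt v) (pt z)].

Definition spannable P : Prop := exists g,
  [/\ symmetric g, forall u v, g u v -> bivisible P u v, noncrossing_drawing g
    & {in P &, forall u v, connect g u v}].

Definition separated P Q c : Prop :=
  forall u v x y p, u \in P -> v \in P -> x \in Q -> y \in Q ->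
  segment (pt u) (pt v) p -> segment (pt x) (pt y) p -> p = pt c.

Lemma separatedC P Q c : separated P Q c -> separated Q P c.
Proof. by move=> sep u v x y p uQ vQ xP yP pQ pP; apply: (sep x y u v). Qed.

(** A blocker z from [Q] spans the degenerate segment zz, so separation forces z = c; but c lies in
    [P] and does not block. *)
Lemma bivisible_setU P Q c u v : c \in P -> separated P Q c ->
  bivisible P u v -> bivisible (P :|: Q)%SET u v.
Proof.
move=> cP sep [uP vP uv vis]; split; rewrite ?inE ?uP ?vP // => z.
rewrite inE => /orP[/vis //|zQ] zuv.
have /pt_inj zc : pt z = pt c.
  by apply: (sep u v z z) => //; [apply: open_segmentW | apply: segment_refl].
by apply: (vis z) zuv; rewrite zc.
Qed.

Lemma bivisible_end P u v c :
  c \in P -> bivisible P u v -> segment (pt u) (pt v) (pt c) ->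
  pt c = pt u \/ pt c = pt v.
Proof. by move=> cP [_ _ _ vis] /segment_split[]; [left|right|move/vis]. Qed.

(** Edges from different drawings meet at most in c, and c, being no blocker, is then an endpoint of
    both. Every point is connected to c. *)
Lemma spannable_glue P Q c : c \in P -> c \in Q -> separated P Q c ->
  spannable P -> spannable Q -> spannable (P :|: Q)%SET.
Proof.
move=> cP cQ sep [g [g_sym g_vis g_nc g_conn]] [h [h_sym h_vis h_nc h_conn]].
have gh_sym : symmetric (relU g h) by move=> u v; rewrite /= g_sym h_sym.
exists (relU g h); split=> //.
- move=> u v /orP[/g_vis|/h_vis] uv; first exact: bivisible_setU cP sep uv.
  by rewrite finset.setUC; apply: bivisible_setU cQ (separatedC sep) uv.
- move=> u v x y /orP[] guv /orP[] gxy ne p pu px.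
  + exact: g_nc guv gxy ne p pu px.
  + have [uP vP _ _] := g_vis _ _ guv; have [xQ yQ _ _] := h_vis _ _ gxy.
    have pc := sep _ _ _ _ _ uP vP xQ yQ pu px; subst p.
    split; [exact: bivisible_end (g_vis _ _ guv) pu|].
    exact: bivisible_end (h_vis _ _ gxy) px.
  + have [uQ vQ _ _] := h_vis _ _ guv; have [xP yP _ _] := g_vis _ _ gxy.
    have pc := sep _ _ _ _ _ xP yP uQ vQ px pu; subst p.
    split; [exact: bivisible_end (h_vis _ _ guv) pu|].
    exact: bivisible_end (g_vis _ _ gxy) px.
  + exact: h_nc guv gxy ne p pu px.
have conn_c u : u \in (P :|: Q)%SET -> connect (relU g h) u c.
  rewrite inE => /orP[uP|uQ].
    apply: connect_sub (g_conn u c uP cP) => a b gab.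
    by apply: connect1; rewrite /= gab.
  apply: connect_sub (h_conn u c uQ cQ) => a b hab.
  by apply: connect1; rewrite /= hab orbT.
move=> u v /conn_c uc /conn_c vc; apply: connect_trans uc _.
by rewrite sym_connect_sym.
Qed.

Lemma separated_lex (h1 h2 : plane R -> R) P Q c :
  affine_fun h1 -> affine_fun h2 -> h1 (pt c) = 0 -> h2 (pt c) = 0 ->
  (forall u, u \in P -> lex_nneg (h1 (pt u), h2 (pt u))) ->
  (forall x, x \in Q -> x != c -> lex_neg (h1 (pt x), h2 (pt x))) ->
  separated P Q c.
Proof.
move=> aff1 aff2 h1c h2c hP hQ u v x y p uP vP xQ yQ [t t01 pE].
move: t01; rewrite /= in_itv /= => t01.
have {t t01 pE uP vP} p_nneg : ~ lex_neg (h1 p, h2 p).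
  by rewrite -pE aff1 aff2; apply: lex_nneg_neg;
    apply: (lex_nneg_conv t01 (hP u uP) (hP v vP)).
move=> [t t01 pE]; move: t01; rewrite /= in_itv /= => t01; subst p.
have t0 : 0 <= t by case/andP: t01.
have t1 : 0 <= 1 - t by case/andP: t01 => _; rewrite subr_ge0.
rewrite aff1 aff2 in p_nneg.
(* If one end of the segment in [Q] is c, where both functions vanish, the other end must have
   weight 0, and the common point is c. *)
have pos_neg (s : R) (a : R * R) : 0 <= s -> lex_neg a ->
    ~ lex_neg (s * a.1, s * a.2) -> s = 0.
  rewrite le0r => /orP[/eqP //|s0] nega.
  by case; case: nega => [?|[-> ?]]; [left|right]; rewrite /= ?mulr0 ?pmulr_rlt0.
have [xc|xc] := eqVneq x c; have [yc|yc] := eqVneq y c.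
- by rewrite xc yc -scalerDl subrK scale1r.
- have := pos_neg _ (_, _) t0 (hQ y yQ yc); rewrite xc h1c h2c !mulr0 !add0r in p_nneg *.
  by move=> /(_ p_nneg) ->; rewrite subr0 scale1r scale0r addr0.
- have := pos_neg _ (_, _) t1 (hQ x xQ xc); rewrite yc h1c h2c !mulr0 !addr0 in p_nneg *.
  move=> /(_ p_nneg)/eqP; rewrite subr_eq0 => /eqP <-.
  by rewrite subrr scale1r scale0r add0r.
- by case: p_nneg; apply: (lex_neg_conv t01 (hQ x xQ xc) (hQ y yQ yc)).
Qed.

Lemma spannable_edge u v : col u != col v -> spannable [set u; v]%SET.
Proof.
move=> uv; exists [rel x y | [set x; y]%SET == [set u; v]%SET]; split.
- by move=> x y /=; rewrite finset.setUC.
- move=> x y /= /eqP e.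
  have xuv : x \in [set u; v]%SET by rewrite -e !inE eqxx.
  have yuv : y \in [set u; v]%SET by rewrite -e !inE eqxx orbT.
  have cxy : col x != col y.
    have := uv; have : u \in [set x; y]%SET by rewrite e !inE eqxx.
    have : v \in [set x; y]%SET by rewrite e !inE eqxx orbT.
    rewrite !inE => /orP[]/eqP -> /orP[]/eqP ->; by rewrite ?eqxx // eq_sym.
  have xy : pt x != pt y by rewrite (inj_eq pt_inj); apply: contraNneq cxy => ->.
  split=> // z; rewrite -e !inE => /orP[]/eqP->; first exact: open_segmentNl.
  by move/open_segmentC; apply: open_segmentNl; rewrite eq_sym.
- by move=> x y x' y' /= /eqP -> /eqP ->; rewrite eqxx.
- move=> x y; rewrite !inE => /orP[]/eqP-> /orP[]/eqP->; rewrite ?connect0 //;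
    apply: connect1; rewrite /= ?eqxx //.
  by rewrite finset.setUC.
Qed.

(* D measures the distance to the line xy, which supports P, and f the position
   along it, the rest of the line lying beyond y. For the closest w of minimal
   angle at y from the ray yx, the triangle xyw meets the hull of P minus {x, y}
   only in w, so that a path through x, y and w can be glued at w. *)
Lemma spannable_hull_edge (D f : plane R -> R) P x y :
  affine_fun D -> affine_fun f ->
  x \in P -> y \in P -> col x != col y ->
  D (pt x) = 0 -> D (pt y) = 0 -> f (pt x) < 0 -> f (pt y) = 0 ->
  (forall q, q \in P -> 0 <= D (pt q)) ->
  (forall q, q \in P -> q != x -> q != y -> D (pt q) = 0 -> 0 < f (pt q)) ->
  (exists2 q, q \in P & D (pt q) != 0) ->
  spannable (P :\: [set x; y])%SET -> spannable P.
Proof.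
move=> affD afff xP yP xy Dx Dy fx fy D_ge0 line_f [q0 q0P Dq0] spanQ.
(* As [f] and [D] vanish at [y], this ratio is constant on rays from [y]; it grows with the angle
   from the ray yx. *)
pose key q := f (pt q) / D (pt q).
have [|w1 /andP[w1P Dw1] w1min] :=
  @finite_argmin T R (fun q => (q \in P) && (D (pt q) != 0)) key.
  by exists q0; rewrite q0P.
have [|w /and3P[wP Dw /eqP wkey] wmin] := @finite_argmin T R
  (fun q => [&& q \in P, D (pt q) != 0 & key q == key w1]) (D \o pt).
  by exists w1; rewrite w1P Dw1 eqxx.
have Dw_gt0 : 0 < D (pt w) by rewrite lt0r Dw D_ge0.
have wx : w != x by apply: contraNneq Dw => ->; rewrite Dx.
have wy : w != y by apply: contraNneq Dw => ->; rewrite Dy.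
(* [h1] vanishes on the line yw, and [h2] on the parallel to xy through [w]; [h2] decides for the
   points on yw. *)
pose h1 p := D (pt w) * f p - f (pt w) * D p.
pose h2 p := D p - D (pt w).
have aff1 : affine_fun h1 by move=> t a b; rewrite /h1 affD afff; ring.
have aff2 : affine_fun h2 by move=> t a b; rewrite /h2 affD; ring.
(* The endpoint of the hull edge whose colour differs from that of [w]. *)
pose z := if col w == col x then y else x.
have zxy : z = x \/ z = y by rewrite /z; case: ifP; [right|left].
have Dz : D (pt z) = 0 by case: zxy => ->.
have span_xyw : spannable ([set x; y] :|: [set w; z])%SET.
  apply: (@spannable_glue _ _ z); rewrite ?inE ?eqxx ?orbT //.
  - by case: zxy => ->; rewrite eqxx ?orbT.
  - apply: (@separated_lex (fun p => - 1 * D p) (fun p => - 1 * D p)).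
    + exact: affine_scale.
    + exact: affine_scale.
    + by rewrite Dz mulr0.
    + by rewrite Dz mulr0.
    + by move=> u; rewrite !inE => /orP[]/eqP->; right; rewrite /= ?Dx ?Dy mulr0 lexx.
    + move=> u; rewrite !inE => /orP[]/eqP-> //; last by rewrite eqxx.
      by left; rewrite /=; lra.
  - exact: spannable_edge.
  - by apply: spannable_edge; rewrite /z; case: ifP => [/eqP -> //|/negbT //].
rewrite (_ : P = (P :\: [set x; y]) :|: ([set x; y] :|: [set w; z]))%SET; last first.
  apply/finset.setP => q; rewrite !inE.
  case: (eqVneq q x) => [->|qx] //=; case: (eqVneq q y) => [->|qy] //=.
  case: (eqVneq q w) => [->|qw] /=; first by rewrite wP.
  by case: zxy => ->; rewrite ?(negbTE qx) ?(negbTE qy) orbF.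
apply: (@spannable_glue _ _ w) => //;
  [by rewrite !inE (negbTE wx) (negbTE wy) | by rewrite !inE eqxx orbT |].
apply: (@separated_lex h1 h2) => //.
- by rewrite /h1; ring.
- by rewrite /h2 subrr.
- move=> q; rewrite !inE negb_or => /andP[/andP[qx qy] qP].
  have [Dq|Dq] := eqVneq (D (pt q)) 0.
    by have := line_f q qP qx qy Dq; left; rewrite /= /h1 Dq; nra.
  have Dq_gt0 : 0 < D (pt q) by rewrite lt0r Dq D_ge0.
  have h1E : h1 (pt q) = D (pt w) * D (pt q) * (key q - key w).
    by rewrite /h1 /key; field; rewrite Dq Dw.
  have : key w <= key q by rewrite wkey; apply: w1min; rewrite qP.
  rewrite le_eqVlt => /orP[/eqP kqw|kqw]; [right|left]; rewrite /= h1E.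
    by rewrite -kqw subrr mulr0 subr_ge0; split=> //; apply: wmin;
      rewrite qP Dq -kqw wkey eqxx.
  by rewrite !mulr_gt0 // subr_gt0.
- have negx : lex_neg (h1 (pt x), h2 (pt x)).
    by rewrite /lex_neg /= /h1 /h2 Dx; left; nra.
  have negy : lex_neg (h1 (pt y), h2 (pt y)).
    by rewrite /lex_neg /= /h1 /h2 Dy fy; right; split; lra.
  move=> q; rewrite !inE => /orP[/orP[]/eqP-> //|/orP[/eqP->|/eqP->]].
    by rewrite eqxx.
  by case: zxy => ->.
Qed.

End Drawings.

(** * The sweep around an extreme point *)

Section Sweep.
Variables (R : realType) (T : finType) (pt : T -> plane R) (col : T -> bool).
Hypothesis pt_inj : injective pt.
Hypothesis bicolored_line_card : forall (L : set (plane R)) u v,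
  is_line L -> L (pt u) -> L (pt v) -> col u != col v ->
  (#|[set q : T | `[< L (pt q) >]]%SET| <= 3)%N.
Implicit Types (P Q : {set T}) (u v w x y z p q r b : T) (d : plane R).

Let spannable := spannable pt col.

Definition excess (c : bool) P : int :=
  \sum_(q in P) (if col q == c then -1 else 1).

Lemma excess0 c : excess c finset.set0 = 0.
Proof. by rewrite /excess big_set0. Qed.

Lemma excessD1 c P x : x \in P ->
  excess c P = (if col x == c then -1 else 1) + excess c (P :\ x)%SET.
Proof. by move=> xP; rewrite /excess (big_setD1 x). Qed.

Lemma excessU c P Q : [disjoint P & Q] ->
  excess c (P :|: Q)%SET = excess c P + excess c Q.
Proof.
move=> PQ; rewrite /excess -bigU //=.
by apply: eq_bigl => q; rewrite !inE.
Qed.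

Lemma excess_swap c c' P : excess c P = 0 -> excess c' P = 0.
Proof.
have [->//|cc' e0] := eqVneq c' c; apply: oppr_inj; rewrite oppr0 -[RHS]e0.
rewrite /excess -sumrN; apply: eq_bigr => q _.
by move: cc' {e0}; case: (col q); case: c; case: c'.
Qed.

Lemma excess_le_card c P : excess c P <= #|P|%:Z.
Proof.
rewrite -natz -sumr_const.
by apply: ler_sum => q _; case: ifP.
Qed.

Lemma excess_same c P :
  {in P, forall q, col q = c} -> excess c P = - #|P|%:Z.
Proof.
move=> same; rewrite /excess (eq_bigr (fun=> -1)); last first.
  by move=> q /same ->; rewrite eqxx.
by rewrite sumr_const mulNrn; congr (- _); rewrite -natz.
Qed.

(* When all depths are positive, depth and slope are projective coordinates
   centred at v: slope is constant on the rays from v and increases with the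
   angle, and depth orders the points of each ray. *)
Definition depth d v q : R := dot d (pt q - pt v).
Definition slope d v q : R := cross d (pt q - pt v) / depth d v q.

Lemma depth_apex d v : depth d v v = 0.
Proof. by rewrite /depth subrr /dot !mxE !mulr0 addr0. Qed.

(* On the ray through p, no point of v's colour comes before one of the other
   colour. *)
Definition free P v d p : Prop :=
  forall q r, q \in P -> r \in P -> q != v -> r != v ->
  slope d v q = slope d v p -> slope d v r = slope d v p ->
  col q = col v -> col r != col v -> depth d v r <= depth d v q.

(** The direction [d] certifies that [v] is extreme. It is kept when a cut keeps [v], so slopes
    remain comparable in the parts. *)
Definition sweepable P v d : Prop :=
  [/\ v \in P, forall q, q \in P -> q != v -> 0 < depth d v q
    & excess (col v) (P :\ v)%SET = 1 \/
      excess (col v) (P :\ v)%SET = 0 /\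
        exists2 p, p \in (P :\ v)%SET & free P v d p].

Lemma free_sub P Q v d p : Q \subset P -> free P v d p -> free Q v d p.
Proof.
by move=> /fintype.subsetP QP fr q r qQ rQ; apply: fr; apply: QP.
Qed.

(** A point v farthest from the origin is extreme: in direction -v, twice the depth of q is at least
    |q - v|^2, because |q| <= |v|. *)
Lemma exists_sweep c P : P != finset.set0 -> excess c P = 0 ->
  exists v d, sweepable P v d.
Proof.
move=> /set0Pn Pn0 e0.
have [v vP vmax] := @finite_argmin T R (fun q => q \in P)
  (fun q => - dot (pt q) (pt q)) Pn0.
exists v, (- pt v); split=> //.
  move=> q qP qv; have := vmax q qP.
  have : 0 < dot (pt q - pt v) (pt q - pt v).
    by apply: dot_gt0; rewrite subr_eq0 (inj_eq pt_inj).
  by rewrite /depth /dot !mxE; lra.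
left; have := excess_swap (col v) e0; rewrite (excessD1 _ vP) eqxx.
by move/eqP; rewrite addrC subr_eq0 => /eqP.
Qed.

(** This is |d|^2 times the cross product of x - v and p - v: an orientation test for the line vx,
    in a form that factors through slopes. *)
Definition side d v x (p : plane R) : R :=
  depth d v x * cross d (p - pt v) - cross d (pt x - pt v) * dot d (p - pt v).

Lemma affine_side d v x : affine_fun (side d v x).
Proof. by move=> t a b; rewrite /side /cross /dot !mxE; ring. Qed.

Lemma side_apex d v x : side d v x (pt v) = 0.
Proof. by rewrite /side /cross /dot !subrr !mxE; ring. Qed.

Lemma sideE d v x q : depth d v x != 0 -> depth d v q != 0 ->
  side d v x (pt q) = depth d v x * depth d v q * (slope d v q - slope d v x).
Proof. by move=> x0 q0; rewrite /side /slope -/(depth d v q); field; rewrite x0. Qed.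

Lemma side_self d v x : side d v x (pt x) = 0.
Proof. by rewrite /side mulrC subrr. Qed.

Lemma same_slope d v x q : depth d v x != 0 -> depth d v q != 0 ->
  slope d v q = slope d v x ->
  pt q = pt v + (depth d v q / depth d v x) *: (pt x - pt v).
Proof.
move=> x0 q0 qx; have d0 : d != 0.
  by apply: contraNneq x0 => ->; rewrite /depth /dot !mxE !mul0r addr0.
apply: (addrI (- pt v)); rewrite addKr addrC; apply: (dot_cross_inj d0).
  by rewrite dotZr -!/(depth d v _) divfK.
rewrite crossZr; have crossE z : depth d v z != 0 ->
    cross d (pt z - pt v) = slope d v z * depth d v z.
  by move=> z0; rewrite /slope divfK.
by rewrite !crossE // qx; field.
Qed.

Definition ray P v d p : {set T} :=
  [set q in (P :\ v)%SET | slope d v q == slope d v p]%SET.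

(** The line through v and b is two-coloured and contains v besides the whole ray, which leaves room
    for two points. *)
Lemma card_ray P v d p b : (forall q, q \in P -> q != v -> 0 < depth d v q) ->
  b \in ray P v d p -> col b != col v -> (#|ray P v d p| <= 2)%N.
Proof.
move=> d_gt0; rewrite !inE => /andP[/andP[bv bP] /eqP bp] cbv.
pose L := [set pt v + t *: (pt b - pt v) | t in [set: R]]%classic.
have L_line : is_line L.
  by exists (pt v), (pt b - pt v); split=> //; rewrite subr_eq0 (inj_eq pt_inj).
have Lv : L (pt v) by exists 0 => //; rewrite scale0r addr0.
have Lb : L (pt b) by exists 1 => //; rewrite scale1r addrC subrK.
have := bicolored_line_card L_line Lb Lv cbv; apply: contraLR.
rewrite -!ltnNge => ray_gt; apply: leq_trans (subset_leq_card
  (_ : (v |: ray P v d p)%SET \subset _)).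
  by rewrite cardsU1 !inE eqxx.
apply/fintype.subsetP => q; rewrite !inE => /orP[/eqP->|]; first by [].
move=> /andP[/andP[qv qP] /eqP qp].
exists (depth d v q / depth d v b) => //.
by rewrite -same_slope ?gt_eqF ?d_gt0 // qp bp.
Qed.

(** * The inductive step *)

Section Induction.
Variables (P : {set T}) (v : T) (d : plane R).
Hypothesis IH : forall Q u e, (#|Q| < #|P|)%N -> sweepable Q u e -> spannable Q.
Hypothesis swP : sweepable P v d.

Let depth_gt0 q : q \in (P :\ v)%SET -> 0 < depth d v q.
Proof. by case: swP => _ dP _; rewrite !inE => /andP[qv /dP]; apply. Qed.

Lemma spannable_balanced c Q :
  (#|Q| < #|P|)%N -> Q != finset.set0 -> excess c Q = 0 -> spannable Q.
Proof.
by move=> QP Qn0 /(exists_sweep Qn0)[u [e swQ]]; apply: IH QP swQ.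
Qed.

(** The sign of [s] covers the first and the last ray at once. If the nearest point x of the ray
    differs from v in colour, vx is a two-coloured hull edge; otherwise x and a point b of the other
    colour form one. *)
Lemma spannable_end_ray s p0 : s != 0 -> p0 \in (P :\ v)%SET ->
  (forall q, q \in (P :\ v)%SET -> 0 <= s * (slope d v q - slope d v p0)) ->
  spannable P \/ {in ray P v d p0, forall q, col q = col v}.
Proof.
move=> s0 p0P p0end; have [vP _ tot] := swP.
have [|x xray xmin] := @finite_argmin T R (fun q => q \in ray P v d p0) (depth d v).
  by exists p0; rewrite inE p0P eqxx.
have [xP xp0] : x \in (P :\ v)%SET /\ slope d v x = slope d v p0.
  by move: xray; rewrite inE => /andP[-> /eqP].
have [xv xP'] : x != v /\ x \in P by move: xP; rewrite !inE => /andP.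
have x_gt0 := depth_gt0 xP.
pose D (a : plane R) := s * side d v x a.
pose f (a : plane R) := dot d (a - pt x).
have affD : affine_fun D by apply: affine_scale; apply: affine_side.
have afff : affine_fun f by move=> t a a'; rewrite /f /dot !mxE; ring.
have Dv : D (pt v) = 0 by rewrite /D side_apex mulr0.
have Dx : D (pt x) = 0 by rewrite /D side_self mulr0.
have DE q : q \in (P :\ v)%SET ->
    D (pt q) = depth d v x * depth d v q * (s * (slope d v q - slope d v p0)).
  by move=> qP; rewrite /D sideE ?gt_eqF ?depth_gt0 // xp0; ring.
have D_ge0 q : q \in P -> 0 <= D (pt q).
  have [->|qv qP] := eqVneq q v; first by rewrite Dv.
  have qPv : q \in (P :\ v)%SET by rewrite !inE qv.
  by rewrite DE // mulr_ge0 ?p0end // mulr_ge0 // ltW // depth_gt0.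
have D_eq0 q : q \in (P :\ v)%SET -> (D (pt q) == 0) = (q \in ray P v d p0).
  move=> qP; rewrite DE // !mulf_eq0 (gt_eqF x_gt0) (gt_eqF (depth_gt0 qP)) (negbTE s0) /=.
  by rewrite subr_eq0 inE qP.
have fE q : f (pt q) = depth d v q - depth d v x.
  by rewrite /f /depth /dot !mxE; ring.
have f_gt0 q : q \in ray P v d p0 -> q != x -> 0 < f (pt q).
  move=> qray qx; rewrite fE subr_gt0 lt_neqAle xmin // andbT.
  apply: contraNneq qx => e; apply/eqP/pt_inj.
  move: qray; rewrite inE => /andP[qP /eqP qp0].
  rewrite (@same_slope d v x q) ?gt_eqF ?depth_gt0 ?qp0 //.
  by rewrite -e divff ?gt_eqF // scale1r addrC subrK.
have [cxv|cxv] := eqVneq (col x) (col v); last first.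
  left; have fv : f (pt v) < 0 by rewrite fE depth_apex; lra.
  have fx : f (pt x) = 0 by rewrite fE subrr.
  have PvE := excessD1 (col v) xP; rewrite (negbTE cxv) in PvE.
  (* With total 0 the set without [v] is balanced, and [v] is attached to [x] alone. *)
  case: tot => [tot|[tot _]]; last first.
    rewrite (_ : P = (P :\ v) :|: [set v; x])%SET; last first.
      apply/finset.setP => q; rewrite !inE.
      by case: eqVneq => [->|_] //=; case: eqVneq => [->|_]; rewrite ?orbF ?orbT.
    apply: (spannable_glue pt_inj (c := x)); rewrite ?inE ?eqxx ?orbT ?xv //.
    - apply: (separated_lex affD afff Dx fx) => q.
        move=> qP; rewrite /lex_nneg /= lt0r D_ge0; last first.
          by move: qP; rewrite inE => /andP[].
        rewrite D_eq0 // andbT; case: (boolP (q \in _)) => [qray|]; last by left.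
        right; split; first by apply/eqP; rewrite D_eq0.
        by have [->|qx] := eqVneq q x; rewrite ?fx // ltW // f_gt0.
      by rewrite !inE => /orP[]/eqP->; rewrite ?eqxx // => _; right.
    - apply: (@spannable_balanced (col v)) => //; last by apply/set0Pn; exists x.
      by rewrite [X in (_ < X)%N](cardsD1 v) vP.
    - by apply: spannable_edge => //; rewrite eq_sym.
  (* With total 1, deleting [v] and [x] leaves weight 0; the hull edge can be put back if some point
     is off its line. *)
  have [/existsP[q0 /andP[q0P Dq0]]|] := boolP [exists q, (q \in P) && (D (pt q) != 0)].
    apply: (@spannable_hull_edge _ _ _ _ pt_inj D f P v x) => //.
    - by rewrite eq_sym.
    - move=> q qP qv qx /eqP; have qPv : q \in (P :\ v)%SET by rewrite !inE qv.
      by rewrite D_eq0 // => /f_gt0; apply.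
    - by exists q0.
    have QE : (P :\: [set v; x] = P :\ v :\ x)%SET.
      by apply/finset.setP => q; rewrite !inE negb_or; case: eqP; case: eqP.
    apply: (@spannable_balanced (col v)).
    - apply: proper_card; apply/properP; split; first exact: subsetDl.
      by exists v; rewrite ?inE ?eqxx.
    - apply/set0Pn; exists q0; rewrite !inE q0P andbT negb_or.
      by apply/andP; split; apply: contraNneq Dq0 => ->; rewrite ?Dv ?Dx.
    - by rewrite QE; apply: (addrI 1); rewrite -PvE tot.
  (* Otherwise all points but [v] are on one ray, so at most one is left besides [v] and [x]; weight
     0 excludes even that one. *)
  rewrite negb_exists => /forallP all0.
  have rayE : ray P v d p0 = (P :\ v)%SET.
    apply/finset.setP => q; rewrite inE; apply: andb_idr => qP.
    have := all0 q; rewrite negb_and negbK D_eq0 // inE qP /=.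
    by move: qP; rewrite inE => /andP[_ ->].
  have := card_ray _ xray cxv.
  case: (swP) => _ dP _ /(_ dP); rewrite rayE (cardsD1 x) xP ltnS => le1.
  have := tot; rewrite PvE => tot1.
  have [Q0|/set0Pn[y yQ]] := eqVneq (P :\ v :\ x)%SET finset.set0.
    rewrite (_ : P = [set v; x]%SET); first by apply: spannable_edge => //; rewrite eq_sym.
    apply/finset.setP => q; move/finset.setP/(_ q): Q0; rewrite !inE.
    case: (eqVneq q v) => [->|_]; first by rewrite vP.
    by case: (eqVneq q x) => [->|_ /= ->]; first by rewrite xP'.
  have card1 : (#|P :\ v :\ x| = 1)%N.
    by apply/eqP; rewrite eqn_leq le1 card_gt0; apply/set0Pn; exists y.
  move: tot1; have /cards1P[z ->] : #|(P :\ v :\ x)%SET| == 1%N by rewrite card1.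
  by rewrite /excess big_set1; case: ifP.
have [/existsP[b /andP[bray cbv]]|] :=
    boolP [exists b, (b \in ray P v d p0) && (col b != col v)]; last first.
  rewrite negb_exists => /forallP same; right => q qray.
  by have := same q; rewrite qray negbK => /eqP.
left; have bx : b != x by apply: contraNneq cbv => ->; rewrite cxv.
have [bP bp0] : b \in (P :\ v)%SET /\ slope d v b = slope d v p0.
  by move: bray; rewrite inE => /andP[-> /eqP].
have [bv bP'] : b != v /\ b \in P by move: bP; rewrite !inE => /andP.
have rayE : ray P v d p0 = [set b; x]%SET.
  apply/esym/eqP; rewrite eqEcard; apply/andP; split.
    by apply/fintype.subsetP => q; rewrite !inE => /orP[]/eqP->;
      [move: bray|move: xray]; rewrite !inE.
  case: (swP) => _ dP _.
  by rewrite cards2 bx; apply: card_ray dP bray cbv.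
have xb := f_gt0 b bray bx.
have Db : D (pt b) = 0 by apply/eqP; rewrite D_eq0.
(* The weights of [b] and [x] cancel, so their removal preserves the total around [v]. *)
have PvE := excessD1 (col v) bP;
rewrite (negbTE cbv) (@excessD1 _ (P :\ v :\ b)%SET x) in PvE; last first.
  by rewrite !inE (eq_sym x b) bx xv xP'.
rewrite cxv eqxx in PvE.
have QE : (P :\ v :\ b :\ x = (P :\: [set b; x]) :\ v)%SET.
  by apply/finset.setP => q; rewrite !inE negb_or; do 3!case: eqP.
have PvE' : excess (col v) ((P :\: [set b; x]) :\ v)%SET = excess (col v) (P :\ v)%SET.
  by rewrite PvE QE; ring.
(* The sign of [f] is reversed because the line now runs from [b] through [x] to [v]. *)
apply: (@spannable_hull_edge _ _ _ _ pt_inj D (fun a => - 1 * f a) P b x) => //.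
- exact: affine_scale.
- by rewrite cxv.
- by lra.
- by rewrite fE subrr mulr0.
- move=> q qP qb qx /eqP; have [->|qv] := eqVneq q v.
    by rewrite fE depth_apex; lra.
  have qPv : q \in (P :\ v)%SET by rewrite !inE qv.
  by rewrite D_eq0 // rayE !inE (negbTE qb) (negbTE qx).
- case: tot => [tot|[tot [q qP qfree]]].
    have /set0Pn[q] : (P :\: [set b; x] :\ v)%SET != finset.set0.
      by apply/eqP => e; move: tot; rewrite -PvE' e excess0.
    rewrite !inE negb_or => /and3P[qv /andP[qb qx] qP]; exists q => //.
    by rewrite D_eq0 ?rayE !inE ?qv // (negbTE qb) (negbTE qx).
  (* The free ray is a different one, since here [x] of the colour of [v] precedes [b]. *)
  exists q; first by move: qP; rewrite inE => /andP[].
  rewrite D_eq0 // inE qP /=; apply/eqP => qp0.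
  have := qfree x b xP' bP' xv bv; rewrite xp0 bp0 qp0 => /(_ erefl erefl cxv cbv).
  by rewrite leNgt; move: xb; rewrite fE subr_gt0 => ->.
apply: (@IH _ v d).
  apply: proper_card; apply/properP; split; first exact: subsetDl.
  by exists b; rewrite ?inE ?eqxx.
case: (swP) => _ dP _; split.
- by rewrite !inE negb_or vP [v == b]eq_sym [v == x]eq_sym bv xv.
- by move=> q; rewrite inE => /andP[_]; apply: dP.
- rewrite PvE'; case: tot => [|[tot [q qP qfree]]]; [by left|right; split=> //].
  exists q; last by apply: free_sub qfree; apply: subsetDl.
  have qp0 : slope d v q != slope d v p0.
    apply/eqP => qp0.
    have := qfree x b xP' bP' xv bv; rewrite xp0 bp0 qp0 => /(_ erefl erefl cxv cbv).
    by rewrite leNgt; move: xb; rewrite fE subr_gt0 => ->.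
  move: qP; rewrite !inE => /andP[-> ->]; rewrite andbT negb_or /=.
  by apply/andP; split; apply: contraNneq qp0 => ->; apply/eqP.
Qed.

Let side_sign x q : x \in (P :\ v)%SET -> q \in (P :\ v)%SET ->
  side d v x (pt q) =
    depth d v x * depth d v q * (slope d v q - slope d v x).
Proof. by move=> xP qP; rewrite sideE ?gt_eqF ?depth_gt0. Qed.

(** One function serves as both coordinates: points on the cutting line may belong to [Q1], while
    [Q2] has only [c] there. Both [v] and [p] can serve as [c]. *)
Let separated_sweep p c Q1 Q2 : p \in (P :\ v)%SET -> side d v p (pt c) = 0 ->
  Q1 \subset P -> Q2 \subset P ->
  {in Q1, forall q, q != v -> slope d v q <= slope d v p} ->
  {in Q2, forall q, q != c -> q != v /\ slope d v p < slope d v q} ->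
  separated pt Q1 Q2 c.
Proof.
move=> pP sc /fintype.subsetP Q1P /fintype.subsetP Q2P le_p gt_p.
have p_gt0 := depth_gt0 pP.
apply: (@separated_lex _ _ _ (fun a => - 1 * side d v p a)
  (fun a => - 1 * side d v p a)); rewrite ?sc ?mulr0 //.
- exact/affine_scale/affine_side.
- exact/affine_scale/affine_side.
- move=> q qQ; apply/lex_nneg_diag; rewrite mulN1r oppr_ge0.
  have [->|qv] := eqVneq q v; first by rewrite side_apex.
  have qP : q \in (P :\ v)%SET by rewrite !inE qv Q1P.
  have := depth_gt0 qP; have := le_p q qQ qv => le_qp q_gt0.
  by rewrite side_sign // pmulr_rle0 ?subr_le0 // mulr_gt0.
- move=> q qQ qc; have [qv gt_qp] := gt_p q qQ qc; left; rewrite /= mulN1r oppr_lt0.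
  have qP : q \in (P :\ v)%SET by rewrite !inE qv Q2P.
  have q_gt0 := depth_gt0 qP.
  by rewrite side_sign // !mulr_gt0 // subr_gt0.
Qed.

Lemma spannable_step : spannable P.
Proof.
have [vP dP tot] := swP.
have tot01 : excess (col v) (P :\ v)%SET = 0 \/ excess (col v) (P :\ v)%SET = 1.
  by case: tot => [|[]]; [right|left].
have /set0Pn Pv_n0 : (P :\ v)%SET != finset.set0.
  apply/eqP => e; case: tot => [|[_ [p]]]; last by rewrite e inE.
  by rewrite e excess0.
have [p0 p0P p0min] := @finite_argmin T R _ (slope d v) Pv_n0.
have [pl plP plmax] := @finite_argmin T R _ (fun q => - slope d v q) Pv_n0.
have [|||//|ray0] := @spannable_end_ray 1 p0.
- exact: oner_neq0.
- exact: p0P.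
- by move=> q qP; rewrite mul1r subr_ge0 p0min.
have [|||//|rayl] := @spannable_end_ray (- 1) pl.
- by rewrite oppr_eq0 oner_neq0.
- exact: plP.
- by move=> q qP; have := plmax q qP; lra.
(* A ray with only the colour of [v] is free, so each part of a cut at [v] inherits a free end
   ray. *)
have free0 : free P v d p0.
  move=> q r qP rP qv rv qp rp _; rewrite ray0 ?eqxx //.
  by rewrite !inE rv rP rp eqxx.
have freel : free P v d pl.
  move=> q r qP rP qv rv qp rp _; rewrite rayl ?eqxx //.
  by rewrite !inE rv rP rp eqxx.
pose upto p := [set q in (P :\ v)%SET | slope d v q <= slope d v p]%SET.
pose below p := [set q in (P :\ v)%SET | slope d v q < slope d v p]%SET.
pose above p := [set q in (P :\ v)%SET | slope d v p < slope d v q]%SET.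
pose F p := excess (col v) (upto p).
have uptoE p : F p = excess (col v) (below p) + excess (col v) (ray P v d p).
  rewrite /F -excessU.
    congr excess; apply/finset.setP => q; rewrite !inE -andb_orr.
    by rewrite le_eqVlt orbC.
  rewrite -setI_eq0; apply/eqP/finset.setP => q; rewrite !inE.
  by case: ltgtP; rewrite ?andbF.
have totE p : excess (col v) (P :\ v)%SET = F p + excess (col v) (above p).
  rewrite /F -excessU.
    congr excess; apply/finset.setP => q; rewrite !inE -andb_orr.
    by rewrite ltNge orbN andbT.
  rewrite -setI_eq0; apply/eqP/finset.setP => q; rewrite !inE.
  by case: ltP; rewrite ?andbF.
have ray_neg p : p \in (P :\ v)%SET ->
    {in ray P v d p, forall q, col q = col v} -> excess (col v) (ray P v d p) < 0.
  move=> pP same; rewrite excess_same // oppr_lt0 ltz_nat card_gt0.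
  by apply/set0Pn; exists p; rewrite inE pP eqxx.
have [|p /andP[pP Fp_ge0] pmin] := @finite_argmin T R
    (fun p => (p \in (P :\ v)%SET) && (0 <= F p)) (slope d v).
  exists pl; rewrite plP /=; have := totE pl.
  rewrite (_ : above pl = finset.set0) ?excess0 ?addr0.
    by move=> <-; case: tot01 => ->.
  apply/finset.setP => q; rewrite inE [RHS]inE; apply/negP => /andP[qP].
  by rewrite ltNge -lerN2 plmax.
have ray_eq p1 : slope d v p1 = slope d v p -> ray P v d p1 = ray P v d p.
  by move=> e; apply/finset.setP => q; rewrite !inE e.
(* If nothing were below, [p] would be on the first ray, which has negative weight. Otherwise the
   points below form the prefix of an earlier ray, negative by the choice of [p]. *)
have below_neg : excess (col v) (below p) < 0.
  have [e|/set0Pn bn0] := eqVneq (below p) finset.set0.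
    have e0 : slope d v p0 = slope d v p.
      apply/eqP; rewrite eq_le p0min // leNgt; apply/negP => lt0.
      suff: p0 \in below p by rewrite e inE.
      by rewrite inE p0P.
    have := Fp_ge0; rewrite uptoE e excess0 add0r -(ray_eq _ e0) leNgt.
    by rewrite ray_neg.
  have [q qb qmax] := @finite_argmin T R _ (fun q => - slope d v q) bn0.
  have [qP qp] : q \in (P :\ v)%SET /\ slope d v q < slope d v p.
    by move: qb; rewrite inE => /andP.
  rewrite (_ : below p = upto q).
    by rewrite ltNge; apply: contraL qp => Fq; rewrite -leNgt pmin // qP.
  apply/finset.setP => r; rewrite !inE -in_setD1; apply: andb_id2l => rP.
  apply/idP/idP => [rp|/le_lt_trans]; last exact.
  by rewrite -lerN2; apply: qmax; rewrite inE rP.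
have ray_pos : 0 < excess (col v) (ray P v d p).
  by move: Fp_ge0; rewrite uptoE; lia.
have [b bray cbv] : exists2 b, b \in ray P v d p & col b != col v.
  apply: contrapT => none; have := ray_neg p pP; rewrite ltNge (ltW ray_pos).
  case/(_ _)/notP => // q qray; apply: contrapT => /eqP cqv.
  by apply: none; exists q.
have ray_le2 := card_ray dP bray cbv.
have ray_ub := excess_le_card (col v) (ray P v d p).
(* At most -1 from below and at most 2 from the ray. *)
have F01 : F p = 0 \/ F p = 1 by move: Fp_ge0; rewrite uptoE; lia.
have p_lt_pl : slope d v p < slope d v pl.
  rewrite lt_neqAle -(lerN2 (slope d v pl)) plmax // andbT.
  apply/negP => /eqP e; have := ray_neg pl plP rayl.
  by rewrite (ray_eq pl (esym e)) ltNge (ltW ray_pos).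
have plA : pl \in above p by rewrite inE plP.
have [v_upto v_above] : v \notin upto p /\ v \notin above p.
  by rewrite !inE eqxx.
have pU : p \in upto p by rewrite inE pP lexx.
have p0U : p0 \in upto p by rewrite inE p0P p0min.
have upP : upto p \subset P.
  by apply/fintype.subsetP => q; rewrite !inE => /andP[/andP[]].
have abP : above p \subset P.
  by apply/fintype.subsetP => q; rewrite !inE => /andP[/andP[]].
have p_notA : p \notin above p by rewrite inE ltxx andbF.
have pl_notU : pl \notin upto p by rewrite inE leNgt p_lt_pl andbF.
have PE : (P = (v |: upto p) :|: above p)%SET.
  apply/finset.setP => q; rewrite !inE.
  have [->|_ /=] := eqVneq q v; first by rewrite vP.
  by rewrite -andb_orr ltNge orbN andbT.
have vU_P : (v |: upto p)%SET \subset P by rewrite finset.subUset finset.sub1set vP.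
have vU_lt : (#|v |: upto p| < #|P|)%N.
  apply: proper_card; apply/properP; split=> //; exists pl.
    exact: (fintype.subsetP abP).
  by rewrite !inE -in_setD1 plP /= negb_or -ltNge p_lt_pl andbT;
    move: plP; rewrite !inE => /andP[].
have vU_le : {in (v |: upto p)%SET, forall q, q != v -> slope d v q <= slope d v p}.
  move=> q; rewrite !inE => /orP[/eqP->|/andP[_ //]]; by rewrite eqxx.
have [/andP[/eqP F1 /eqP tot0]|] :=
    boolP ((F p == 1) && (excess (col v) (P :\ v)%SET == 0)).
  (* The ray of p has weight 2, hence consists of two points whose colour is not
     that of v. *)
  have cpv : col p != col v.
    apply/eqP => cpv; have pray : p \in ray P v d p by rewrite inE pP eqxx.
    have := excess_le_card (col v) (ray P v d p :\ p)%SET.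
    have := cardsD1 p (ray P v d p); rewrite pray.
    have := excessD1 (col v) pray; rewrite cpv eqxx.
    move: F1 below_neg ray_le2; rewrite uptoE.
    move: (excess _ _) (excess _ _) (excess _ _) => i j k.
    by move: #|_| #|_| => m n; clear; lia.
  have A1 : excess (col v) (above p) = - 1.
    by apply: (addrI (F p)); rewrite -(totE p) tot0 F1 subrr.
  (* Both parts are balanced: [v] adds -1 to the prefix weight 1, and [p] adds 1 to the weight -1
     above. *)
  rewrite (_ : P = (v |: upto p) :|: (p |: above p))%SET; last first.
    rewrite {1}PE; apply/finset.setP => q; rewrite !inE.
    have [->|] := eqVneq q p; rewrite ?orbT //=.
    by move: pP; rewrite !inE => ->; rewrite lexx orbT.
  apply: (spannable_glue pt_inj (c := p)); rewrite ?inE ?eqxx ?pU ?orbT //.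
  - by move: pP; rewrite !inE lexx => ->; rewrite orbT.
  - apply: (separated_sweep pP); rewrite ?side_self //.
      by rewrite finset.subUset finset.sub1set abP andbT; apply: (fintype.subsetP upP).
    by move=> q; rewrite !inE => /orP[/eqP->|/andP[/andP[]]] //; rewrite eqxx.
  - apply: (@spannable_balanced (col v)) => //.
      by apply/set0Pn; exists v; rewrite !inE eqxx.
    by rewrite (excessD1 _ (setU11 _ _)) eqxx setU1K // -/(F p) F1.
  - apply: (@spannable_balanced (col v)) => //.
    + apply: proper_card; apply/properP; split.
        by rewrite finset.subUset finset.sub1set abP andbT; apply: (fintype.subsetP upP).
      exists v => //; rewrite !inE eqxx orbF eq_sym.
      by move: pP; rewrite !inE => /andP[].
    + by apply/set0Pn; exists p; rewrite !inE eqxx.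
    + by rewrite (excessD1 _ (setU11 _ _)) (negbTE cpv) setU1K // A1.
move=> not_jump.
(* Total and prefix weight are now (0,0), (1,0) or (1,1), leaving 0, 1 or 0 above, so both parts can
   be swept from [v]. *)
rewrite (_ : P = (v |: upto p) :|: (v |: above p))%SET; last first.
  by rewrite {1}PE; apply/finset.setP => q; rewrite !inE; case: eqP.
apply: (spannable_glue pt_inj (c := v)); rewrite ?inE ?eqxx //.
- apply: (separated_sweep pP); rewrite ?side_apex //.
    by rewrite finset.subUset finset.sub1set vP.
  by move=> q; rewrite !inE => /orP[/eqP->|/andP[/andP[]]] //; rewrite eqxx.
- apply: (@IH _ v d) => //; split.
  + by rewrite !inE eqxx.
  + by move=> q /(fintype.subsetP vU_P); apply: dP.
  + rewrite setU1K // -/(F p); case: F01 => ->; [right|by left]; split=> //.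
    by exists p0 => //; apply: free_sub free0.
- have vA_P : (v |: above p)%SET \subset P by rewrite finset.subUset finset.sub1set vP.
  apply: (@IH _ v d); last split.
  + apply: proper_card; apply/properP; split=> //; exists p.
      exact: (fintype.subsetP upP).
    by rewrite !inE ltxx andbF orbF; move: pP; rewrite !inE => /andP[].
  + by rewrite !inE eqxx.
  + by move=> q /(fintype.subsetP vA_P); apply: dP.
  + rewrite setU1K //.
    have [e0|e1] : excess (col v) (above p) = 0 \/ excess (col v) (above p) = 1.
      move: not_jump tot01; rewrite (totE p).
      by case: F01 => ->; move: (excess _ _) => i; clear; lia.
      right; split=> //; exists pl => //; exact: free_sub freel.
    by left.
Qed.

End Induction.

Lemma balanced_spannable c P : P != finset.set0 -> excess c P = 0 -> spannable P.
Proof.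
move=> Pn0 /(exists_sweep Pn0)[v [d]].
have [n] := ubnP #|P|; elim: n P v d {Pn0} => // n IHn P v d; rewrite ltnS => Pn sw.
apply: (@spannable_step P v d) => // Q u e QP; apply: IHn.
exact: leq_trans QP Pn.
Qed.

End Sweep.

(** * Application to the two point sets *)

Lemma card_fset_sub (K : choiceType) (S : {fset K}) (p : pred K) :
  #|[set q : S | p (val q)]%SET| = #|` [fset x in S | p x]%fset|.
Proof. by rewrite cardsE -sum1_card card_fset_sum1 -big_fset_condE big_seq_fsetE. Qed.

Theorem theorem17 (R : realType) (n : nat) (A B : {fset plane R})
    (disjAB : [disjoint A & B]%fset)
    (cardA : #|` A| = n) (cardB : #|` B| = n)
    (lineAB : forall L : set (plane R), AB_line A B L ->
      (#|` [fset p in (A `|` B)%fset | p \in L]%fset| <= 3)%N) :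
  exists t : rel (A `|` B)%fset,
    spanning_tree (bivisibility A B) t /\ noncrossing t.
Proof.
pose S := (A `|` B)%fset; pose pt (q : S) := val q; pose col (q : S) := val q \in A.
have pt_inj : injective pt by exact: val_inj.
have colB (q : S) : (val q \in B) = ~~ col q.
  have := fsvalP q; rewrite in_fsetU /col => qAB.
  have [qA|qA] /= := boolP (val q \in A); last by move: qAB; rewrite (negbTE qA).
  by apply/negbTE; apply: (fdisjointP disjAB).
have line_card (L : set (plane R)) u v : is_line L -> L (pt u) -> L (pt v) ->
    col u != col v -> (#|[set q : S | `[< L (pt q) >]]%SET| <= 3)%N.
  move=> L_line Lu Lv uv; rewrite (card_fset_sub S (fun p => `[< L p >])).
  have AB_L : AB_line A B L.
    split=> //.
      have [uA|uA] := boolP (col u); first by exists (pt u).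
      by exists (pt v) => //; move: uv; rewrite (negbTE uA); case: (boolP (col v)).
    have [uA|uA] := boolP (col u); last by exists (pt u); rewrite // colB uA.
    by exists (pt v) => //; rewrite colB; move: uv; rewrite uA; case: (col v).
  exact: lineAB AB_L.
have balanced : excess col true [set: S]%SET = 0.
  have cA : #|[set q : S | col q]%SET| = n.
    rewrite (card_fset_sub S (mem A)) -cardA; congr (#|` _|).
    by apply/fsetP => x; rewrite !inE andbC /=; case: (x \in A).
  have cB : #|[set q : S | ~~ col q]%SET| = n.
    rewrite (card_fset_sub S (fun x => x \notin A)) -cardB; congr (#|` _|).
    apply/fsetP => x; rewrite !inE /=.
    have [xA|_] /= := boolP (x \in A); last by rewrite andbT.
    by apply/esym/negbTE; apply: (fdisjointP disjAB).
  rewrite /excess (bigID col) /=.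
  rewrite (eq_bigr (fun=> -1)) => [|q /andP[_ ->] //].
  rewrite [X in _ + X](eq_bigr (fun=> 1)) => [|q /andP[_ /negbTE ->] //].
  rewrite !sumr_const (eq_card (B := [set q : S | col q]%SET)) => [|q]; last first.
    by rewrite [LHS]unfold_in !inE.
  rewrite cA (eq_card (B := [set q : S | ~~ col q]%SET)) => [|q]; last first.
    by rewrite [LHS]unfold_in !inE.
  by rewrite cB mulNrn addrC subrr.
have [g [g_sym g_vis g_nc g_conn]] : spannable pt col [set: S]%SET.
  (* For n = 0 there is no extreme point to start from, and the empty drawing is taken. *)
  have [S0|Sn0] := eqVneq [set: S]%SET finset.set0.
    exists [rel x y | false]; split=> // x y; by rewrite S0 inE.
  exact: (balanced_spannable pt_inj line_card Sn0 balanced).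
have g_simple : simple_graph g.
  by split=> // x; apply/negP => /g_vis[_ _]; rewrite eqxx.
have [t [t_g t_tree]] : exists t, spanning_tree g t.
  by apply: has_spanning_tree => // x y; apply: g_conn; rewrite inE.
exists t; split; last first.
  by move=> u v x y /t_g uv /t_g xy; apply: g_nc.
split=> // u v /t_g /g_vis[_ _ uv vis]; apply/andP; split.
  by rewrite !colB -/(col u) -/(col v); move: uv; do 2!case: (col _).
apply/forallP => z; apply/negP; rewrite inE; apply: vis.
by rewrite inE.
Qed.
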